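(* Let $P_{\underline m}$ be any parabolic subgroup of $G=GL(n,\mathbb{R})$, associated with a composition $\underline m=(m_1,\dots,m_l)$ of $n$, and let $B'$ be the standard Borel subgroup of $GL(n-1,\mathbb{R})\times GL(1,\mathbb{R})$. Denote by $(e_1,\dots,e_{n-1})$ the canonical basis of $\mathbb{R}^{n-1}$. Then any $B'$-orbit of $\mathcal D_{\underline m}\simeq G/P_{\underline m}$ admits a representative given by $$A=\begin{bmatrix}A_1&\cdots&A_l\end{bmatrix}$$ where each block $A_j$ is of the form $$\begin{pmatrix}e_{i_{j,1}}&\cdots&e_{i_{j,m_j}}\\0&\cdots&0\end{pmatrix}\qquad(1)$$ except exactly one of them which is of the form $$\begin{pmatrix}\displaystyle\sum_{s=1}^k e_{i_s}&e_{i_{j,2}}&\cdots&e_{i_{j,m_j}}\\1&0&\cdots&0\end{pmatrix}\qquad(2)$$ for some $k\in\{0,\dots,l-1\}$. Moreover, - all basis vectors $e_{i_{j,j'}}$ involved are distinct; - if the block $A_{j_0}$ is of the form (2), then there exists an increasing sequence $j_0<j_1<\cdots<j_k$ such that $e_{i_s}$ appears in the block $A_{j_s}$ for all $s\in\{1,\dots,k\}$. This normal form is unique up to permutations of the vectors $e_{i_{j,j'}}$ in each block $A_j$.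
   Context: A composition of $n$ is a finite sequence of positive integers with sum $n$. $P_{\underline m}\subset GL(n,\mathbb{R})$ denotes the standard parabolic subgroup of invertible block upper triangular matrices with diagonal blocks of sizes $m_1,\dots,m_l$. $GL(n-1,\mathbb{R})\times GL(1,\mathbb{R})$ is embedded block diagonally in $GL(n,\mathbb{R})$ and $B'$ is its subgroup of upper triangular matrices; it acts on $G/P_{\underline m}$ by left multiplication. $\mathcal D_{\underline m}$ is the variety of flags $V_1\subset\cdots\subset V_l=\mathbb{R}^n$ with $\dim V_j=m_1+\cdots+m_j$, identified with $G/P_{\underline m}$. The notation $[A_1\ \cdots\ A_l]$, with $A_j$ a real $n\times m_j$ matrix and $(A_1\ \cdots\ A_l)$ invertible, denotes the flag for which $V_j$ is the span of the columns of $A_1,\dots,A_j$. In the displayed blocks, the upper row consists of column vectors in $\mathbb{R}^{n-1}$ and the lower row is the last row of the matrix.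
   Formalization: The normal form additionally requires i_1 > i_2 > ... > i_k (for j_1 < ... < j_k); without it uniqueness fails, e.g. for n=3, m=(1,1,1), [e_1+e_2+e_3 | e_1 | e_2] and [e_2+e_3 | e_1 | e_2] lie in the same B'-orbit. *)

(* Defs.v *)
From HB Require Import structures.
From mathcomp Require Import all_boot all_order all_fingroup all_algebra.
From mathcomp Require Import reals.

Set Implicit Arguments.
Unset Strict Implicit.
Unset Printing Implicit Defensive.

Import Order.TTheory GRing.Theory Num.Theory.
Local Open Scope ring_scope.

(* R : realType stands for the field of real numbers. *)

Definition composition (N l : nat) (m : 'I_l -> nat) : Prop :=
  (forall j, (0 < m j)%N) /\ (\sum_(j < l) m j)%N = N.

(* D_m, as a predicate on families of subspaces of R^N. *)
Definition is_flag (R : realType) (N l : nat) (m : 'I_l -> nat)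
    (V : 'I_l -> {vspace 'cV[R]_N}) : Prop :=
  [/\ forall i j : 'I_l, (i <= j)%N -> (V i <= V j)%VS,
      forall j : 'I_l, \dim (V j) = (\sum_(k < l | k <= j) m k)%N
    & forall j : 'I_l, j.+1 = l -> V j = fullv].

(* [A_1 ... A_l] *)
Definition flag_mx (R : realType) (N l : nat) (m : 'I_l -> nat)
    (A : forall j : 'I_l, 'M[R]_(N, m j)) : 'I_l -> {vspace 'cV[R]_N} :=
  fun j => (\sum_(k < l | (k <= j)%N) \sum_(c < m k) <[col c (A k)]>)%VS.

Definition act_flag (R : realType) (N l : nat) (g : 'M[R]_N)
    (V : 'I_l -> {vspace 'cV[R]_N}) : 'I_l -> {vspace 'cV[R]_N} :=
  fun j => (linfun (mulmx g) @: V j)%VS.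

(* The parabolic subgroup P_m of GL(N), with N written as the sum of m. *)
Definition parabolic (R : realType) (l : nat) (m : 'I_l -> nat)
    (p : 'M[R]_(\sum_(j < l) m j)) : Prop :=
  p \in unitmx /\ forall i j : 'I_l, (j < i)%N -> submxblock p i j = 0.

(* The identification of G / P_m with D_m, g P_m being sent to the flag of the
   blocks of columns of g: this flag lies in D_m (flag_mx_is_flag), every
   element of D_m is obtained (flag_unitmxP), and g, h have the same flag
   exactly when h belongs to g P_m (flag_mx_eqP). *)
Section FlagVariety.
Variables (R : realType) (l : nat) (m : 'I_l -> nat).
Let N := (\sum_(j < l) m j)%N.
Implicit Types g h p : 'M[R]_N.

Let fl g := flag_mx (submxrow g).

Lemma col_span k (B : 'M[R]_(N, k)) (x : 'cV[R]_k) :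
  B *m x = \sum_(c < k) x c 0 *: col c B.
Proof.
apply/colP=> i; rewrite !mxE summxE; apply: eq_bigr => c _.
by rewrite !mxE mulrC.
Qed.

Lemma mulmx_blocks g (w : 'cV[R]_N) :
  g *m w = \sum_(i < l) submxrow g i *m submxcol w i.
Proof. by rewrite -{1}[g]submxrowK -{1}[w]submxcolK mul_mxrow_mxcol. Qed.

Lemma mem_block k (B : 'M[R]_(N, k)) v :
  v \in (\sum_(c < k) <[col c B]>)%VS -> exists x : 'cV[R]_k, v = B *m x.
Proof.
move=> /memv_sumP[v_ v_in ->].
have /fin_all_exists[x_ Dx] : forall c, exists a, v_ c = a *: col c B.
  by move=> c; have /vlineP[a ->] := v_in c isT; exists a.
exists (\col_c x_ c); rewrite col_span; apply: eq_bigr => c _.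
by rewrite mxE Dx.
Qed.

Lemma mem_flag g (j : 'I_l) (w : 'cV[R]_N) : g \in unitmx ->
  (g *m w \in fl g j) <-> (forall i : 'I_l, (j < i)%N -> submxcol w i = 0).
Proof.
move=> gU; split; last first.
  move=> w0; rewrite mulmx_blocks (bigID (fun i : 'I_l => (i <= j)%N)) /=.
  rewrite [X in _ + X]big1 ?addr0; last first.
    by move=> i; rewrite -ltnNge => /w0->; rewrite mulmx0.
  apply: memv_sumr => i ij; rewrite col_span; apply: memv_sumr => c _.
  by rewrite memvZ ?memv_line.
move=> /memv_sumP[v_ v_in eqw] i ji.
have /fin_all_exists[x_ Dx] : forall k, exists x : 'cV[R]_(m k),
    (k <= j)%N -> v_ k = submxrow g k *m x.
  move=> k; case: (leqP k j) => [kj|_]; last by exists 0.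
  by have [x Dx] := mem_block (v_in k kj); exists x.
pose u : 'cV[R]_N := \mxcol_k (if (k <= j)%N then x_ k else 0).
have -> : w = u.
  apply: (can_inj (mulKmx gU)); rewrite eqw mulmx_blocks.
  rewrite [RHS](bigID (fun i : 'I_l => (i <= j)%N)) /=.
  rewrite [X in _ + X]big1 ?addr0; last first.
    by move=> k kj; rewrite mxcolK (negPf kj) mulmx0.
  by apply: eq_bigr => k kj; rewrite mxcolK kj Dx.
by rewrite mxcolK leqNgt ji.
Qed.

Lemma col_submx_flag g (j k : 'I_l) (c : 'I_(m k)) :
  (k <= j)%N -> col c (submxrow g k) \in fl g j.
Proof.
move=> kj; rewrite memvE /fl /flag_mx.
by apply: (sumv_sup k) => //; apply: (sumv_sup c).
Qed.

Lemma sub_flag g (j : 'I_l) (U : {vspace 'cV[R]_N}) :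
  (forall (k : 'I_l) (c : 'I_(m k)), (k <= j)%N -> col c (submxrow g k) \in U) ->
  (fl g j <= U)%VS.
Proof.
move=> gU; apply/subv_sumP => k kj; apply/subv_sumP => c _.
by rewrite -memvE gU.
Qed.

Lemma dim_block k (B : 'M[R]_(N, k)) : (\dim (\sum_(c < k) <[col c B]>) <= k)%N.
Proof.
apply: (@leq_trans (\sum_(c < k) \dim <[col c B]>)); first exact: dimv_leq_sum.
rewrite -[leqRHS]card_ord -sum1_card; apply: leq_sum => c _.
by rewrite dim_vline leq_b1.
Qed.

Lemma flag_full g :
  g \in unitmx -> (\sum_(k < l) \sum_(c < m k) <[col c (submxrow g k)]>)%VS = fullv.
Proof.
move=> gU; apply: subv_anti; rewrite subvf; apply/subvP => v _.
rewrite -(mulKVmx gU v) mulmx_blocks.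
apply: memv_sumr => i ij; rewrite col_span; apply: memv_sumr => c _.
by rewrite memvZ ?memv_line.
Qed.

Lemma flag_mx_is_flag g : g \in unitmx -> is_flag m (fl g).
Proof.
move=> gU; split=> [i j ij|j|j jl].
- by apply: sub_flag => k c ki; apply: col_submx_flag (leq_trans ki ij).
- pose S (P : pred 'I_l) := (\sum_(k < l | P k) \sum_(c < m k) <[col c (submxrow g k)]>)%VS.
  have dimS P : (\dim (S P) <= \sum_(k < l | P k) m k)%N.
    apply: (@leq_trans (\sum_(k < l | P k) \dim (\sum_(c < m k) <[col c (submxrow g k)]>))).
      exact: dimv_leq_sum.
    by apply: leq_sum => k _; apply: dim_block.
  pose P := [pred k : 'I_l | (k <= j)%N].
  have dimP := dimS P; have dimCP := dimS (predC P).
  have : (N <= \dim (S P) + \dim (S (predC P)))%N.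
    apply: leq_trans (dimv_add_leqif _ _).
    have -> : (S P + S (predC P))%VS = fullv by rewrite -(flag_full gU) [RHS](bigID P).
    by rewrite dimvf /dim /= muln1.
  rewrite {1}/N (bigID P) /= => le_sum.
  apply/eqP; rewrite eqn_leq dimP /=.
  by rewrite -(leq_add2r (\sum_(k < l | ~~ P k) m k)) (leq_trans le_sum) // leq_add2l.
- rewrite -(flag_full gU) /fl /flag_mx; apply: eq_bigl => k.
  by rewrite -ltnS jl ltn_ord.
Qed.

Lemma flag_unitmxP (V : 'I_l -> {vspace 'cV[R]_N}) :
  is_flag m V -> exists2 g, g \in unitmx & V =1 fl g.
Proof.
case=> Vmono Vdim Vfull.
pose U j := (\sum_(k < l | (k < j)%N) V k)%VS.
have UV (j : 'I_l) : (U j <= V j)%VS.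
  by apply/subv_sumP => k kj; apply: Vmono (ltnW kj).
have dimU (j : 'I_l) : \dim (U j) = (\sum_(k < l | (k < j)%N) m k)%N.
  case: (posnP j) => [j0|jgt0].
    by rewrite /U !big_pred0 ?dimv0 // => k; rewrite j0.
  have j1l : (j.-1 < l)%N by rewrite (leq_ltn_trans (leq_pred _) (ltn_ord j)).
  pose i := Ordinal j1l.
  have ltE k : (k < j)%N = (k <= i)%N by rewrite -[RHS]ltnS prednK.
  have -> : U j = V i.
    apply/eqP; rewrite eqEsubv; apply/andP; split.
      by apply/subv_sumP => k kj; rewrite Vmono // -ltE.
    by apply: (sumv_sup i); rewrite ?ltE.
  by rewrite Vdim; apply: eq_bigl => k; rewrite ltE.
pose C (j : 'I_l) := (V j :\: U j)%VS.
have dimC j : \dim (C j) = m j.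
  have := dimv_cap_compl (V j) (U j); rewrite (capv_idPr (UV j)) dimU Vdim.
  rewrite [RHS](bigD1 j) //= addnC => /eqP.
  have -> : (\sum_(k < l | (k <= j)%N && (k != j)) m k)%N
          = (\sum_(k < l | (k < j)%N) m k)%N.
    by apply: eq_bigl => k; rewrite ltn_neqAle andbC.
  by rewrite eqn_add2r => /eqP.
pose g : 'M[R]_N := \mxrow_j \matrix_(r < N, c < m j) ((vbasis (C j))`_c r 0).
have colg j (c : 'I_(m j)) : col c (submxrow g j) = (vbasis (C j))`_c.
  by apply/colP=> r; rewrite mxrowK !mxE.
have Cspan j : (\sum_(c < m j) <[col c (submxrow g j)]>)%VS = C j.
  apply/eqP; rewrite eqEsubv; apply/andP; split.
    apply/subv_sumP => c _; rewrite -memvE colg vbasis_mem // mem_nth //.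
    by rewrite size_tuple dimC.
  rewrite -[X in (X <= _)%VS](span_basis (vbasisP (C j))).
  apply/span_subvP => x /(nthP 0)[c cs <-].
  have cm : (c < m j)%N by rewrite size_tuple dimC in cs.
  by rewrite memvE; apply: (sumv_sup (Ordinal cm)); rewrite // colg.
have flE : V =1 fl g.
  move=> j; rewrite /fl /flag_mx (eq_bigr C) => [|k _]; last exact: Cspan.
  have [a] := ubnP j; elim: a j => // a IH j; rewrite ltnS => ja.
  apply/eqP; rewrite eqEsubv; apply/andP; split; last first.
    by apply/subv_sumP => k kj; rewrite (subv_trans (diffvSl _ _)) ?Vmono.
  rewrite -[X in (X <= _)%VS](addv_diff_cap _ (U j)) (capv_idPr (UV j)).
  rewrite subv_add (sumv_sup j) //=; apply/subv_sumP => k kj.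
  rewrite IH ?(leq_trans kj) //.
  by apply/subv_sumP => i ik; rewrite (sumv_sup i) // (leq_trans ik (ltnW kj)).
exists g => //.
have full (v : 'cV[R]_N) : exists w, v = g *m w.
  case: (posnP l) => [l0|lgt0].
    exists 0; rewrite mulmx0; apply/colP => -[i iN]; exfalso.
    by move: iN; rewrite /N big_pred0 // => -[j]; rewrite l0.
  have jl : (l.-1 < l)%N by rewrite prednK.
  pose j := Ordinal jl.
  have : v \in fl g j by rewrite -flE Vfull ?memvf //= prednK.
  case/memv_sumP=> v_ v_in ->.
  have /fin_all_exists[x_ Dx] : forall k, exists x : 'cV[R]_(m k),
      v_ k = submxrow g k *m x.
    move=> k; have kj : (k <= j)%N by rewrite -ltnS prednK.
    by apply: mem_block (v_in k kj).
  exists (\mxcol_k x_ k); rewrite mulmx_blocks; apply: eq_big => k.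
    by rewrite -ltnS prednK ?ltn_ord.
  by rewrite mxcolK.
have /fin_all_exists[w_ Dw] i := full (delta_mx i 0).
have gw : g *m (\matrix_(r, c) w_ c r 0) = 1%:M.
  apply/matrixP=> r c; move/colP/(_ r): (Dw c); rewrite !mxE andbT => ->.
  by apply: eq_bigr => s _; rewrite mxE.
by case: (mulmx1_unit gw).
Qed.

Lemma flag_mx_eqP g h : g \in unitmx -> h \in unitmx ->
  (fl g =1 fl h) <-> exists2 p, parabolic p & h = g *m p.
Proof.
move=> gU hU.
have key (p : 'M[R]_N) : h = g *m p ->
    (forall j, (fl h j <= fl g j)%VS) <->
    (forall i j : 'I_l, (j < i)%N -> submxblock p i j = 0).
  move=> Dh; have colh j c : col c (submxrow h j) = g *m col c (submxrow p j).
    by rewrite Dh -mul_submxrow !colE mulmxA.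
  have blkE i j c : submxcol (col c (submxrow p j)) i = col c (submxblock p i j).
    by rewrite submxblockEh; apply/matrixP=> r s; rewrite !mxE.
  split=> [hg i j ji|p0 j].
    apply/matrixP=> r c; rewrite [RHS]mxE.
    have := subvP (hg j) _ (col_submx_flag h c (leqnn j)).
    rewrite colh mem_flag // => /(_ i ji); rewrite blkE => /colP/(_ r).
    by rewrite !mxE.
  apply: sub_flag => k c kj; rewrite colh mem_flag // => i ji.
  by rewrite blkE p0 ?(leq_ltn_trans kj) // linear0.
split=> [gh|[p [pU p0] Dh] j].
  exists (invmx g *m h); last by rewrite mulKVmx.
  split; first by rewrite unitmx_mul unitmx_inv gU.
  by apply/(key _ (esym (mulKVmx gU h))) => j; rewrite gh.
have [_ dg _] := flag_mx_is_flag gU; have [_ dh _] := flag_mx_is_flag hU.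
by apply/eqP; rewrite eq_sym eqEdim dg dh leqnn andbT; apply: (key p Dh).2.
Qed.

End FlagVariety.

(* In the definitions below the ambient space is R^(n + 1) = R^n x R, so that
   n plays the role of "n - 1". *)

(* GL(n) x GL(1), embedded block diagonally in GL(n + 1). *)
Definition levi (R : realType) (n : nat) (g : 'M[R]_(n + 1)) : Prop :=
  exists (h : 'M[R]_n) (d : 'M[R]_1),
    [/\ h \in unitmx, d \in unitmx & g = block_mx h 0 0 d].

(* The Borel subgroup B'; is_trig_mx means lower triangular. *)
Definition borel (R : realType) (n : nat) (b : 'M[R]_(n + 1)) : Prop :=
  levi b /\ is_trig_mx b^T.

Definition borel_orbit (R : realType) (n l : nat)
    (V W : 'I_l -> {vspace 'cV[R]_(n + 1)}) : Prop :=
  exists2 b : 'M[R]_(n + 1), borel b & W =1 act_flag b V.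

(* e_i in R^n (indices start at 0), and the column (e_i, 0) of R^(n + 1). *)
Definition evec (R : realType) (n : nat) (i : 'I_n) : 'cV[R]_n := delta_mx i 0.

Definition ecol (R : realType) (n : nat) (i : 'I_n) : 'cV[R]_(n + 1) :=
  col_mx (evec R i) 0.

Definition appears_in (R : realType) (n p : nat) (i : 'I_n)
    (B : 'M[R]_(n + 1, p)) : Prop :=
  exists c : 'I_p, col c B = ecol R i.

Definition block_form1 (R : realType) (n p : nat) (B : 'M[R]_(n + 1, p)) : Prop :=
  forall c : 'I_p, exists i : 'I_n, col c B = ecol R i.

Definition block_form2 (R : realType) (n p k : nat) (i_ : 'I_k -> 'I_n)
    (B : 'M[R]_(n + 1, p)) : Prop :=
  forall c : 'I_p,
    if c == 0%N :> nat then col c B = col_mx (\sum_(s < k) evec R (i_ s)) 1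
    else exists i : 'I_n, col c B = ecol R i.

(* The columns (e_i, 0) are pairwise distinct; the special first column of the
   block of the second form is not of this shape, its last entry being 1. *)
Definition distinct_basis_columns (R : realType) (n l : nat) (m : 'I_l -> nat)
    (A : forall j : 'I_l, 'M[R]_(n + 1, m j)) : Prop :=
  forall (i : 'I_n) (j j' : 'I_l) (c : 'I_(m j)) (c' : 'I_(m j')),
    col c (A j) = ecol R i -> col c' (A j') = ecol R i ->
    Tagged (fun j => 'I_(m j)) c = Tagged (fun j => 'I_(m j)) c'.

(* The last condition fixes the order of the terms of the sum: as the blocks
   j_ s move to the right, the indices i_ s decrease.  Without it the form is
   not unique.  For m = (1, 1, 1), the unipotent b of B' with
   b e_1 = e_1, b e_2 = e_2 - e_1, b e_3 = e_3 maps the flag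
   [e_1 + e_2 + e_3 | e_1 | e_2] to [e_2 + e_3 | e_1 | e_2]. *)
Definition normal_form (R : realType) (n l : nat) (m : 'I_l -> nat)
    (A : forall j : 'I_l, 'M[R]_(n + 1, m j)) : Prop :=
  exists (j0 : 'I_l) (k : 'I_l) (i_ : 'I_k -> 'I_n),
    [/\ forall j, j != j0 -> block_form1 (A j),
        block_form2 i_ (A j0),
        distinct_basis_columns A
      & exists j_ : 'I_k -> 'I_l,
          [/\ forall s, (j0 < j_ s)%N,
              forall s t : 'I_k, (s < t)%N -> (j_ s < j_ t)%N,
              forall s, appears_in (i_ s) (A (j_ s))
            & forall s t : 'I_k, (s < t)%N -> (i_ t < i_ s)%N]].

(* Main.v *)
Require Import Defs.
From HB Require Import structures.
From mathcomp Require Import all_boot all_order all_fingroup all_algebra.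
From mathcomp Require Import boolp reals.

Set Implicit Arguments.
Unset Strict Implicit.
Unset Printing Implicit Defensive.

Import Order.TTheory GRing.Theory Num.Theory.
Local Open Scope ring_scope.

(* Call p the leading index of x if x_p is the last nonzero entry of x; the
   elements of B' preserve leading indices.  Let L p be the least level j at
   which V j contains a vector with leading index p.  Choosing for each p such
   a vector in V (L p) gives a basis adapted to the flag (Bruhat); in its terms
   B' only has to normalize the vector attached to the last index, the pivot.
   Order the indices by p <= q and L p <= L q: the group acting on that vector
   is the unit group of the incidence algebra of this poset, so that the orbit
   is determined by the down-set generated by the support, hence by the
   antichain T of its maximal elements.  As the last index belongs to T, the
   antichain condition alone yields j_0 < j_1 < ... < j_k.  Both L and T are
   invariants of the orbit, which gives uniqueness. *)

(** * Leading indices and invertible upper triangular matrices *)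

Section LeadingEntry.
Variables (F : fieldType) (N : nat).
Implicit Types (p q : 'I_N) (x : 'cV[F]_N) (g h : 'M[F]_N).

Definition leads p x := x p 0 != 0 /\ forall q, (p < q)%N -> x q 0 = 0.

(** Invertible upper triangular matrices, encoded column by column so that their products and
    inverses are handled through leading indices alone. *)
Definition upper_unit g := forall p, leads p (col p g).

Lemma leads_delta p : leads p (delta_mx p 0).
Proof.
split=> [|q pq]; rewrite !mxE ?eqxx ?oner_eq0 //.
by rewrite andbT -val_eqE gtn_eqF.
Qed.

Lemma leads_inj p q x : leads p x -> leads q x -> p = q.
Proof.
move=> [xp px] [xq qx]; apply: val_inj; case: (ltngtP p q) => // [/px|/qx] x0.
  by rewrite x0 eqxx in xq.
by rewrite x0 eqxx in xp.
Qed.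

Lemma leads_exists x : x != 0 -> exists p, leads p x.
Proof.
move=> x0; have [p xp] : exists p, x p 0 != 0.
  apply/existsP; apply: contraNT x0 => /existsPn x0.
  by apply/eqP/colP=> p; rewrite mxE; apply/eqP; move: (x0 p); rewrite negbK.
have [q xq qmax] := @arg_maxnP _ p (fun p => x p 0 != 0) val xp.
exists q; split=> // r qr; apply: contraTeq qr => /qmax.
by rewrite -leqNgt.
Qed.

(** The nonzero term of largest index cannot be cancelled: in row [p] and in the later rows, every
    other term vanishes. *)
Lemma leads_sum (P : pred 'I_N) (a : 'I_N -> F) (u : 'I_N -> 'cV[F]_N) p :
  (forall q, P q -> leads q (u q)) -> P p -> a p != 0 ->
  (forall q, P q -> a q != 0 -> (q <= p)%N) ->
  leads p (\sum_(q | P q) a q *: u q).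
Proof.
move=> uq Pp ap pmax.
have below q (r : 'I_N) : P q -> (q < r)%N -> (p <= r)%N -> (a q *: u q) r 0 = 0.
  by move=> Pq qr pr; rewrite mxE (uq q Pq).2 ?mulr0.
have small q : P q -> q != p -> a q != 0 -> (q < p)%N.
  by move=> Pq qp aq; rewrite ltn_neqAle [_ == _](inj_eq val_inj) qp pmax.
split=> [|r pr]; rewrite summxE.
  rewrite (bigD1 p) //= big1 ?addr0; last first.
    move=> q /andP[Pq qp]; have [->|aq] := eqVneq (a q) 0.
      by rewrite scale0r mxE.
    by rewrite below ?small.
  by rewrite mxE mulf_neq0 ?(uq p Pp).1.
rewrite big1 // => q Pq; have [->|aq] := eqVneq (a q) 0.
  by rewrite scale0r mxE.
by rewrite below ?(ltnW pr) // (leq_ltn_trans _ pr) ?pmax.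
Qed.

Lemma mulmx_sum_col g x : g *m x = \sum_p x p 0 *: col p g.
Proof.
apply/colP=> i; rewrite !mxE summxE; apply: eq_bigr => c _.
by rewrite !mxE mulrC.
Qed.

Lemma leads_mul g x p : upper_unit g -> leads p x -> leads p (g *m x).
Proof.
move=> gU [xp px]; rewrite mulmx_sum_col; apply: leads_sum => // q _ xq.
by rewrite leqNgt; apply: contraNN xq => /px->.
Qed.

(** As [x] is nonzero it has a leading index, which by [leads_mul] is also that of [g *m x]. *)
Lemma leads_mulK g x p : upper_unit g -> leads p (g *m x) -> leads p x.
Proof.
move=> gU gx; have x0 : x != 0.
  by apply/eqP=> x0; case: gx; rewrite x0 mulmx0 mxE eqxx.
have [q xq] := leads_exists x0.
by rewrite (leads_inj gx (leads_mul gU xq)).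
Qed.

Lemma upper_unitM g h : upper_unit g -> upper_unit h -> upper_unit (g *m h).
Proof. by move=> gU hU p; rewrite colE -mulmxA -colE; apply: leads_mul. Qed.

Lemma upper_unitP g :
  upper_unit g <-> is_trig_mx g^T /\ forall p, g p p != 0.
Proof.
split=> [gU|[/is_trig_mxP gT gD] p].
  split=> [|p]; last by case: (gU p); rewrite mxE.
  by apply/is_trig_mxP => p q pq; case: (gU p) => _ /(_ q pq); rewrite !mxE.
by split=> [|q /gT]; rewrite !mxE.
Qed.

Lemma trig_unitmxP g : is_trig_mx g^T -> (g \in unitmx) <-> upper_unit g.
Proof.
move=> gT; rewrite upper_unitP -unitmx_tr unitmxE det_trig // unitfE.
split=> [/prodf_neq0 gD|[_ gD]].
  by split=> // p; have := gD p isT; rewrite mxE.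
by apply/prodf_neq0 => p _; rewrite mxE.
Qed.

Lemma upper_unit_unitmx g : upper_unit g -> g \in unitmx.
Proof. by move=> gU; apply/trig_unitmxP=> //; case/upper_unitP: gU. Qed.

Lemma upper_unitV g : upper_unit g -> upper_unit (invmx g).
Proof.
move=> gU p; apply: (leads_mulK gU).
rewrite colE mulKVmx ?upper_unit_unitmx //.
exact: leads_delta.
Qed.

End LeadingEntry.

(** * The Borel subgroup B' *)

Section Borel.
Variables (R : realType) (n : nat).
Implicit Types (p q : 'I_(n + 1)) (g h : 'M[R]_(n + 1)).

Definition pivot : 'I_(n + 1) := rshift n ord0.

Lemma leq_pivot p : (p <= pivot)%N.
Proof. by have := ltn_ord p; rewrite /= addn0 [X in (_ < X)%N]addn1 ltnS. Qed.

Lemma ltn_pivot p : (p < pivot)%N = (p != pivot).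
Proof. by rewrite ltn_neqAle leq_pivot andbT -val_eqE. Qed.

Lemma lshift_pivot (i : 'I_n) : (lshift 1 i == pivot) = false.
Proof. exact: eq_lrshift. Qed.

Lemma pivotVlshift p : p = pivot \/ exists i : 'I_n, p = lshift 1 i.
Proof.
case: (split_ordP p) => [i|i] ->; first by right; exists i.
by left; rewrite [i]ord1.
Qed.

(** Triangularity already clears the last row to the left of the pivot, so block diagonality only
    constrains the last column. *)
Lemma borelP g :
  borel g <-> upper_unit g /\ exists d, col pivot g = d *: delta_mx pivot 0.
Proof.
split=> [[[h [d [hU dU ->]]]] gT|].
  split; first by apply/trig_unitmxP; rewrite // unitmxE det_ublock unitrM -!unitmxE hU.
  exists (d 0 0); apply/colP=> p; rewrite mxE.
  case: (pivotVlshift p) => [->|[i ->]].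
    by rewrite block_mxEdr !mxE !eqxx mulr1.
  by rewrite block_mxEur !mxE lshift_pivot mulr0.
move=> [gU [d gd]]; have /upper_unitP[gT gD] := gU.
split=> //; exists (ulsubmx g), (drsubmx g).
have gE : g = block_mx (ulsubmx g) 0 0 (drsubmx g).
  rewrite -{1}[g]submxK; congr block_mx; apply/matrixP=> i j; rewrite !mxE ord1.
    have -> : g (lshift 1 i) (rshift n 0) = col pivot g (lshift 1 i) 0 by rewrite mxE.
    by rewrite gd !mxE lshift_pivot mulr0.
  move/is_trig_mxP: gT => /(_ (lshift 1 j) pivot); rewrite mxE; apply.
  by rewrite ltn_pivot lshift_pivot.
have := upper_unit_unitmx gU.
rewrite {1}gE unitmxE det_ublock unitrM -!unitmxE => /andP[hU dU].
by split.
Qed.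

Lemma borel_unitmx g : borel g -> g \in unitmx.
Proof. by case/borelP => /upper_unit_unitmx. Qed.

Lemma borelM g h : borel g -> borel h -> borel (g *m h).
Proof.
move=> /borelP[gU [d gd]] /borelP[hU [e he]]; apply/borelP.
split; first exact: upper_unitM.
by exists (e * d); rewrite colE -mulmxA -colE he -scalemxAr -colE gd scalerA.
Qed.

Lemma borelV g : borel g -> borel (invmx g).
Proof.
move=> gB; have gu := borel_unitmx gB; have /borelP[gU [d gd]] := gB.
apply/borelP; split; first exact: upper_unitV.
have d0 : d != 0.
  by apply/eqP=> d0; have [] := gU pivot; rewrite gd d0 scale0r mxE eqxx.
exists d^-1; apply: (can_inj (mulKmx gu)).
by rewrite colE mulKVmx // -scalemxAr -colE gd scalerA mulVf // scale1r.
Qed.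

End Borel.
Arguments pivot {n}.

(** * Action on flags and the orbit relation *)

Section Action.
Variables (R : realType) (N l : nat).
Implicit Types (g h : 'M[R]_N) (V W : 'I_l -> {vspace 'cV[R]_N}).

Lemma mem_act_flag g V j x :
  g \in unitmx -> (g *m x \in act_flag g V j) = (x \in V j).
Proof.
move=> gU; apply/memv_imgP/idP => [[y yV]|xV].
  by rewrite lfunE /= => /(can_inj (mulKmx gU)) ->.
by exists x; rewrite ?lfunE.
Qed.

(** Turns images of subspaces into a membership test on vectors, the form in which orbits are
    handled below. *)
Lemma act_flagP g V W : g \in unitmx ->
  (W =1 act_flag g V) <-> (forall j x, (g *m x \in W j) = (x \in V j)).
Proof.
move=> gU; split=> [WV j x|WV j]; first by rewrite WV mem_act_flag.
by apply/vspaceP => x; rewrite -(mulKVmx gU x) WV mem_act_flag.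
Qed.

Lemma dim_act_flag g V j : g \in unitmx -> \dim (act_flag g V j) = \dim (V j).
Proof.
move=> gU; apply: limg_dim_eq; apply/eqP; rewrite -subv0.
apply/subvP => x /memv_capP[_]; rewrite memv_ker lfunE /= memv0 => /eqP gx.
by rewrite -(mulKmx gU x) gx mulmx0.
Qed.

End Action.

Lemma borel_orbit_sym (R : realType) (n l : nat)
    (V W : 'I_l -> {vspace 'cV[R]_(n + 1)}) :
  borel_orbit V W -> borel_orbit W V.
Proof.
move=> [b bB]; have bU := borel_unitmx bB; rewrite act_flagP // => VW.
exists (invmx b); first exact: borelV.
rewrite act_flagP ?unitmx_inv // => j x.
by rewrite -VW mulKVmx.
Qed.

Lemma borel_orbit_trans (R : realType) (n l : nat)
    (U V W : 'I_l -> {vspace 'cV[R]_(n + 1)}) :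
  borel_orbit U V -> borel_orbit V W -> borel_orbit U W.
Proof.
move=> [b bB]; have bU := borel_unitmx bB; rewrite act_flagP // => UV.
move=> [c cB]; have cU := borel_unitmx cB; rewrite act_flagP // => VW.
exists (c *m b); first exact: borelM.
rewrite act_flagP ?unitmx_mul ?cU // => j x.
by rewrite -mulmxA VW UV.
Qed.

(** * Standard flags and their orbit invariants *)

Section StandardFlag.
Variables (R : realType) (n l : nat).
Implicit Types (L : 'I_(n + 1) -> 'I_l) (T : {set 'I_(n + 1)}).
Implicit Types (j : 'I_l) (p q s t : 'I_(n + 1)) (x : 'cV[R]_(n + 1)).

(* T is an antichain when p is compared with q through the pairs (p, L p) and
   (q, L q), ordered componentwise. *)
Definition antichain L T := {in T &, forall s t, (s < t)%N -> (L t < L s)%N}.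

(* T is always assumed to contain the pivot: the column of the pivot is then
   the special column of form (2). *)
Definition std_col T p : 'cV[R]_(n + 1) :=
  if p == pivot then \col_q (q \in T)%:R else delta_mx p 0.

(** Coordinates in the basis [std_col T]: the coefficient of the special column is read off in the
    last row, and its contribution is subtracted from the other rows. *)
Definition std_coord T x p : R :=
  if p == pivot then x pivot 0 else x p 0 - (p \in T)%:R * x pivot 0.

Definition std_flag L T (j : 'I_l) : {vspace 'cV[R]_(n + 1)} :=
  (\sum_(p | (L p <= j)%N) <[std_col T p]>)%VS.

Lemma leads_std_col T p : pivot \in T -> leads p (std_col T p).
Proof.
rewrite /std_col; case: eqP => [-> pT|_ _]; last exact: leads_delta.
split=> [|q]; first by rewrite mxE pT oner_eq0.
by rewrite ltnNge leq_pivot.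
Qed.

Lemma std_colE T (a : 'I_(n + 1) -> R) p : pivot \in T ->
  (\sum_q a q *: std_col T q) p 0
    = a p + ((p != pivot) && (p \in T))%:R * a pivot.
Proof.
move=> piT; rewrite summxE (bigD1 pivot) //= {1}/std_col eqxx !mxE.
have rest q : q != pivot -> (a q *: std_col T q) p 0 = (p == q)%:R * a q.
  by move=> qpi; rewrite /std_col (negPf qpi) !mxE andbT mulrC.
rewrite (eq_bigr _ rest); have [->|ppi] /= := eqVneq p pivot.
  rewrite piT mulr1 mul0r big1 // => q.
  by rewrite eq_sym => /negPf->; rewrite mul0r.
rewrite (bigD1 p) //= eqxx mul1r big1 ?addr0.
  by rewrite addrC [a pivot * _]mulrC.
by move=> q /andP[_]; rewrite eq_sym => /negPf->; rewrite mul0r.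
Qed.

Lemma std_colK T x : pivot \in T -> \sum_p std_coord T x p *: std_col T p = x.
Proof.
move=> piT; apply/colP => p; rewrite std_colE // /std_coord eqxx.
by case: eqVneq => [->|_] /=; rewrite ?mul0r ?addr0 ?subrK.
Qed.

Lemma std_coordK T (a : 'I_(n + 1) -> R) p :
  pivot \in T -> std_coord T (\sum_q a q *: std_col T q) p = a p.
Proof.
move=> piT; rewrite /std_coord !std_colE // eqxx mul0r addr0.
by case: eqVneq => [->|_] //=; rewrite addrK.
Qed.

Lemma mem_std_flag L T j x : pivot \in T ->
  (x \in std_flag L T j) <-> forall p, (j < L p)%N -> std_coord T x p = 0.
Proof.
move=> piT; split=> [/memv_sumP[v v_in ->] p jp|x0].
  have /fin_all_exists[a Da] q : exists a, (L q <= j)%N -> v q = a *: std_col T q.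
    case: (leqP (L q) j) => [qj|_]; last by exists 0.
    by have /vlineP[a ->] := v_in q qj; exists a.
  rewrite big_mkcond (eq_bigr (fun q => (if (L q <= j)%N then a q else 0) *: std_col T q)).
    by rewrite std_coordK // leqNgt jp.
  by move=> q _; case: ifP => [/Da|]; rewrite ?scale0r.
rewrite -(std_colK x piT) (bigID (fun p => (L p <= j)%N)) /= addrC big1 ?add0r.
  by apply: memv_sumr => p pj; rewrite memvZ ?memv_line.
by move=> p; rewrite -ltnNge => /x0->; rewrite scale0r.
Qed.

Lemma std_col_flag L T p j : (L p <= j)%N -> std_col T p \in std_flag L T j.
Proof. by move=> pj; rewrite memvE; apply: (sumv_sup p). Qed.

Lemma std_coord_leads T x p : leads p x -> std_coord T x p = x p 0.
Proof.
move=> [_ px]; rewrite /std_coord; case: eqVneq => [->|ppi] //.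
by rewrite (px pivot) ?ltn_pivot // mulr0 subr0.
Qed.

(** Together with [leads_std_col], this makes [L p] the least level of the standard flag that
    contains a vector of leading index [p]. *)
Lemma leads_std_flag L T j x p :
  pivot \in T -> x \in std_flag L T j -> leads p x -> (L p <= j)%N.
Proof.
move=> piT /(mem_std_flag _ _ _ piT) xj px; rewrite leqNgt; apply/negP => /xj.
by rewrite std_coord_leads //; case: px => /eqP.
Qed.

Lemma level_borel_orbit L L' T T' p : pivot \in T -> pivot \in T' ->
  borel_orbit (std_flag L T) (std_flag L' T') -> (L' p <= L p)%N.
Proof.
move=> piT piT' [b bB]; have bU := borel_unitmx bB; rewrite act_flagP // => bE.
have /borelP[bT _] := bB.
apply: (leads_std_flag piT' _ (leads_mul bT (leads_std_col p piT))).
by rewrite bE std_col_flag.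
Qed.

(** The image of the special column has equal nonzero entries in rows [s'] and [pivot], so row [s']
    of [b] has a nonzero entry in some column [s] of [T]. Such an entry forces [s' <= s] by
    triangularity, and [L s' <= L s] because [b] maps e_s into level [L s]. *)
Lemma below_borel_orbit L T T' s' : pivot \in T -> pivot \in T' ->
    antichain L T' -> borel_orbit (std_flag L T) (std_flag L T') -> s' \in T' ->
  exists s, [/\ s \in T, (s' <= s)%N & (L s' <= L s)%N].
Proof.
move=> piT piT' T'L [b bB]; have bU := borel_unitmx bB; rewrite act_flagP // => bE s'T.
have /borelP[bT [d bpi]] := bB.
have [->|s'pi] := eqVneq s' pivot; first by exists pivot.
have xpi := (leads_mul bT (leads_std_col pivot piT)).1.
have: b *m std_col T pivot \in std_flag L T' (L pivot) by rewrite bE std_col_flag.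
(* By the antichain condition [s'] has a level above that of the pivot, so the coordinate of the
   image at [s'] is zero. *)
move/(mem_std_flag _ _ _ piT')/(_ s').
rewrite /std_coord (negPf s'pi) s'T mul1r.
move/(_ (T'L _ _ s'T piT' _)); rewrite ltn_pivot s'pi => /(_ isT)/eqP.
rewrite subr_eq0 => /eqP x_s'.
have [s bs sT] : exists2 s, b s' s != 0 & s \in T.
  apply/exists_inP; apply: contraNT xpi => /exists_inPn b0.
  rewrite -x_s' mxE big1 // => s _; rewrite /std_col eqxx mxE.
  have [->|bs] := eqVneq (b s' s) 0; first by rewrite mul0r.
  by rewrite (negPf (b0 s bs)) mulr0.
(* Block diagonality: the last column of [b] vanishes outside the pivot. *)
have spi : s != pivot.
  apply: contraNneq bs => ->; have <- : col pivot b s' 0 = b s' pivot by rewrite mxE.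
  by rewrite bpi !mxE (negPf s'pi) mulr0.
exists s; split=> //.
  rewrite leqNgt; apply: contraNN bs => ss'.
  by have [_ /(_ _ ss')] := bT s; rewrite mxE => ->.
have: b *m std_col T s \in std_flag L T' (L s) by rewrite bE std_col_flag.
rewrite {1}/std_col (negPf spi) -colE => /(mem_std_flag _ _ _ piT')/(_ s') bs0.
rewrite leqNgt; apply: contraNN bs => /bs0/eqP.
rewrite /std_coord (negPf s'pi) !mxE.
have [_ /(_ pivot)] := bT s; rewrite ltn_pivot mxE => -> //.
by rewrite mulr0 subr0.
Qed.

(** In a chain [s' <= s <= s''] of the poset with both ends in the antichain [T'], the ends
    coincide, hence [s' = s]. *)
Lemma antichain_sub L T T' : antichain L T' ->
    (forall s', s' \in T' -> exists s, [/\ s \in T, (s' <= s)%N & (L s' <= L s)%N]) ->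
    (forall s, s \in T -> exists s', [/\ s' \in T', (s <= s')%N & (L s <= L s')%N]) ->
  {subset T' <= T}.
Proof.
move=> T'L below above s' s'T; have [s [sT s's Ls's]] := below _ s'T.
have [s'' [s''T ss'' Lss'']] := above _ sT.
have := leq_trans s's ss''; rewrite leq_eqVlt => /predU1P[E|].
  suff -> : s' = s by [].
  by apply/val_inj/eqP; rewrite eqn_leq s's /= E.
by move/(T'L _ _ s'T s''T); rewrite ltnNge (leq_trans Ls's).
Qed.

Lemma std_flag_inj L L' T T' : pivot \in T -> pivot \in T' ->
    antichain L T -> antichain L' T' ->
    borel_orbit (std_flag L T) (std_flag L' T') -> L = L' /\ T = T'.
Proof.
move=> piT piT' TL T'L VV'; have V'V := borel_orbit_sym VV'.
have E : L = L'.
  apply/funext => p; apply/val_inj/eqP; rewrite eqn_leq.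
  by rewrite (level_borel_orbit p piT' piT V'V) (level_borel_orbit p piT piT' VV').
rewrite -E in T'L VV' V'V *; split=> //; apply/eqP; rewrite eqEsubset.
have TT' := below_borel_orbit piT piT' T'L VV'.
have T'T := below_borel_orbit piT' piT TL V'V.
by apply/andP; split; apply/subsetP; apply: (@antichain_sub L) => // s /T'T.
Qed.

End StandardFlag.

(** * Levels of an arbitrary flag *)

Section Reduction.
Variables (R : realType) (n l : nat) (V : 'I_l -> {vspace 'cV[R]_(n + 1)}).
Hypothesis V_mono : forall i j : 'I_l, (i <= j)%N -> (V i <= V j)%VS.
Implicit Types (L : 'I_(n + 1) -> 'I_l) (T : {set 'I_(n + 1)}).
Implicit Types (j : 'I_l) (p q s t : 'I_(n + 1)) (x : 'cV[R]_(n + 1)).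

Lemma flag_level (j1 : 'I_l) : V j1 = fullv ->
  exists (L : 'I_(n + 1) -> 'I_l) (u : 'I_(n + 1) -> 'cV[R]_(n + 1)),
    [/\ forall p, leads p (u p), forall p, u p \in V (L p)
      & forall p j x, x \in V j -> leads p x -> (L p <= j)%N].
Proof.
(* The existence of a vector is decided classically, so that a minimum over levels can be taken;
   [j1] is always admissible. *)
move=> V1; pose P p j := `[< exists2 x, x \in V j & leads p x >].
have P1 p : P p j1.
  by apply/asboolP; exists (delta_mx p 0); [rewrite V1 memvf | apply: leads_delta].
pose L p := [arg min_(j < j1 | P p j) (j : nat)].
have LP p : exists x, x \in V (L p) /\ leads p x.
  by rewrite /L; case: arg_minnP => // j /asboolP[x xj px] _; exists x.
have [u uP] := fin_all_exists LP.
exists L, u; split=> [p|p|p j x xj px]; try by case: (uP p).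
rewrite /L; case: arg_minnP => // i _; apply.
by apply/asboolP; exists x.
Qed.

Variable L : 'I_(n + 1) -> 'I_l.
Hypothesis L_min : forall p j x, x \in V j -> leads p x -> (L p <= j)%N.

(* Otherwise the terms of level greater than j would sum to a vector of V j
   whose leading entry has level greater than j. *)
Lemma level_support (u : 'I_(n + 1) -> 'cV[R]_(n + 1)) (a : 'I_(n + 1) -> R) j :
    (forall p, leads p (u p)) -> (forall p, u p \in V (L p)) ->
    \sum_p a p *: u p \in V j ->
  forall p, (j < L p)%N -> a p = 0.
Proof.
move=> up uV; rewrite (bigID (fun p => (L p <= j)%N)) /= addrC rpredDr; last first.
  by apply: memv_suml => p pj; rewrite memvZ // (subvP (V_mono pj)).
move=> xV p jp; apply/eqP/negPn/negP => ap.
pose P q := (j < L q)%N && (a q != 0).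
have [q /andP[jq aq] qmax] := @arg_maxnP _ p P val (introT andP (conj jp ap)).
have /(L_min xV) : leads q (\sum_(i | ~~ (L i <= j)%N) a i *: u i).
  apply: leads_sum => // [|i]; rewrite -ltnNge // => ji ai.
  by apply: qmax; rewrite /P ji.
by rewrite leqNgt jq.
Qed.

End Reduction.

(** * A standard flag in every orbit *)

Section Existence.
Variables (R : realType) (n l : nat) (V : 'I_l -> {vspace 'cV[R]_(n + 1)}).
Hypothesis V_mono : forall i j : 'I_l, (i <= j)%N -> (V i <= V j)%VS.
Implicit Types (L : 'I_(n + 1) -> 'I_l) (T : {set 'I_(n + 1)}).
Implicit Types (j : 'I_l) (p q s t : 'I_(n + 1)) (x : 'cV[R]_(n + 1)).

(** The columns [g *m std_col R T p] lead at [p] and lie in [V (L p)], so by [level_support] the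
    vectors of [V j] only involve those of level at most [j]. *)
Lemma flag_adapted_basis (L : 'I_(n + 1) -> 'I_l) T (g : 'M[R]_(n + 1)) :
    (forall p j x, x \in V j -> leads p x -> (L p <= j)%N) ->
    pivot \in T -> borel g -> (forall p, g *m std_col R T p \in V (L p)) ->
  borel_orbit (std_flag R L T) V.
Proof.
move=> L_min piT gB gV; have gU := borel_unitmx gB; exists g => //.
rewrite act_flagP // => j x; have /borelP[gT _] := gB.
rewrite -(std_colK x piT) linear_sum.
rewrite (eq_bigr (fun p => std_coord T x p *: (g *m std_col R T p))); last first.
  by move=> p _; rewrite linearZ.
apply/idP/idP => [gxj|].
  apply/mem_std_flag => // p; rewrite std_coordK //.
  apply: (level_support V_mono L_min _ gV gxj) => q.
  by apply: leads_mul => //; apply: leads_std_col.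
move/mem_std_flag => /(_ piT) x0.
apply: memv_suml => p _; case: (leqP (L p) j) => [pj|/x0].
  by rewrite memvZ // (subvP (V_mono pj)).
by rewrite std_coordK // => ->; rewrite scale0r mem0v.
Qed.

Section Tops.
Variables (L : 'I_(n + 1) -> 'I_l) (A : {set 'I_(n + 1)}).

Definition below s t := (s <= t)%N && (L s <= L t)%N.

(** Several maximal elements of [A] may lie above [s]; maximizing the sum of the two coordinates
    selects one of them. *)
Definition top s : 'I_(n + 1) :=
  [arg max_(t > s | (t \in A) && below s t) (t + L t)%N].

Lemma topP s : s \in A -> [/\ top s \in A, below s (top s)
  & forall t, t \in A -> below (top s) t -> t = top s].
Proof.
move=> sA; rewrite /top; case: arg_maxnP => [|t /andP[tA st] tmax].
  by rewrite sA /below !leqnn.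
split=> // r rA /andP[tr Ltr].
have : (r + L r <= t + L t)%N.
  apply: tmax; rewrite rA; case/andP: st => st Lst.
  by rewrite /below (leq_trans st) ?(leq_trans Lst).
move=> rt; apply/val_inj/eqP; rewrite eqn_leq /= tr andbT.
by rewrite -(leq_add2r (L t)) (leq_trans _ rt) ?leq_add2l.
Qed.

Lemma top_id s : s \in A -> top (top s) = top s.
Proof.
move=> /topP[tA _ tmax]; have [ttA ttt _] := topP tA.
exact: tmax ttA ttt.
Qed.

Lemma top_pivot : pivot \in A -> top pivot = pivot.
Proof.
move=> /topP[_ /andP[pit _] _]; apply/eqP.
by rewrite -[_ == _]negbK -ltn_pivot -leqNgt.
Qed.

Lemma antichain_top : antichain L (top @: A).
Proof.
move=> _ _ /imsetP[s sA ->] /imsetP[t tA ->] st; rewrite ltnNge; apply/negP => Lst.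
have [_ _ smax] := topP sA; have [ttA _ _] := topP tA.
have E : top t = top s by apply: smax ttA _; rewrite /below ltnW.
by rewrite E ltnn in st.
Qed.

End Tops.

(* T consists of the maximal elements of the support A of u pivot in the basis
   u0.  Each term of u pivot is assigned to an element of T above it, and the
   terms assigned to s replace u0 s; for s = pivot they lie in V (L pivot),
   except the term of e_pivot, and are dropped. *)
Lemma exists_std_flag (j1 : 'I_l) : V j1 = fullv ->
  exists (L : 'I_(n + 1) -> 'I_l) (T : {set 'I_(n + 1)}),
    [/\ pivot \in T, antichain L T & borel_orbit (std_flag R L T) V].
Proof.
move=> V1; have [L [u [up uV L_min]]] := flag_level V1.
(* With e_pivot in place of [u pivot], the matrix of the basis belongs to B'. *)
pose u0 p := if p == pivot then delta_mx pivot 0 else u p.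
have u0p p : leads p (u0 p).
  by rewrite /u0; case: eqP => [->|_] //; apply: leads_delta.
pose mx (v : 'I_(n + 1) -> 'cV[R]_(n + 1)) : 'M[R]_(n + 1) := \matrix_(q, p) v p q 0.
have col_mx v p : col p (mx v) = v p by apply/colP => q; rewrite !mxE.
have mxP v d : (forall p, leads p (v p)) -> v pivot = d *: delta_mx pivot 0 -> borel (mx v).
  by move=> vp vpi; apply/borelP; split=> [p|]; last exists d; rewrite col_mx.
have UB : borel (mx u0) by apply: (@mxP _ 1) => //; rewrite /u0 eqxx scale1r.
pose a p := (invmx (mx u0) *m u pivot) p 0.
have u_pivot : u pivot = \sum_p a p *: u0 p.
  rewrite -{1}(mulKVmx (borel_unitmx UB) (u pivot)) mulmx_sum_col.
  by apply: eq_bigr => p _; rewrite col_mx.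
(* Only the term of e_pivot reaches the last row. *)
have a_pivot : a pivot != 0.
  have [+ _] := up pivot; apply: contraNneq => a0; rewrite u_pivot summxE big1 // => p _.
  rewrite mxE; have [->|ppi] := eqVneq p pivot; first by rewrite a0 mul0r.
  by have [_ ->] := u0p p; rewrite ?mulr0 ?ltn_pivot.
pose A := [set p | a p != 0].
have piA : pivot \in A by rewrite inE.
pose T := top L A @: A.
have piT : pivot \in T by rewrite -(top_pivot L piA) imset_f.
have TA t : t \in T -> t \in A by case/imsetP => s /(topP L)[tA _ _] ->.
have topT t : t \in T -> top L A t = t by case/imsetP => s sA ->; apply: top_id.
pose u' p := if p == pivot then a pivot *: delta_mx pivot 0 else
  if p \in T then \sum_(i in A | top L A i == p) a i *: u0 i else u p.
have u'p p : leads p (u' p).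
  rewrite /u'; case: eqP => [->|_].
    have [d0 d1] := leads_delta R (@pivot n).
    by split=> [|q pq]; rewrite mxE ?mulf_neq0 // d1 ?mulr0.
  (* The term of [p] is present because [p] is its own top; the other terms assigned to [p] have
     smaller indices. *)
  case: ifP => // pT; apply: leads_sum => //; first by rewrite TA //= topT.
    by have := TA _ pT; rewrite inE.
  by move=> q /andP[qA /eqP <-] _; have [_ /andP[]] := topP L qA.
have gB : borel (mx u') by apply: (@mxP _ (a pivot)); rewrite // /u' eqxx.
(* Monotonicity carries a term to the level of its top. The pivot is excluded: e_pivot, unlike
   [u pivot], need not lie in [V (L pivot)]. *)
have termV i : i \in A -> i != pivot -> a i *: u0 i \in V (L (top L A i)).
  move=> iA ipi; rewrite memvZ // /u0 (negPf ipi).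
  by apply: subvP (uV i); apply: V_mono; have [_ /andP[]] := topP L iA.
exists L, T; split=> //; first exact: antichain_top.
apply: (flag_adapted_basis L_min piT gB) => p.
rewrite /std_col; have [->|ppi] := eqVneq p pivot; last first.
  rewrite -colE col_mx /u' (negPf ppi); case: ifP => // pT.
  apply: memv_suml => i /andP[iA /eqP ti]; rewrite -ti; apply: termV => //.
  by apply: contraNneq ppi => ipi; rewrite -ti ipi top_pivot.
have gpi : mx u' *m \col_q (q \in T)%:R = \sum_(t in T) u' t.
  rewrite mulmx_sum_col [RHS]big_mkcond; apply: eq_bigr => t _.
  by rewrite col_mx mxE; case: ifP; rewrite ?scale1r ?scale0r.
have u_pivotT : u pivot = \sum_(t in T) \sum_(i in A | top L A i == t) a i *: u0 i.
  rewrite u_pivot -partition_big_imset [LHS](bigID [in A]) /= [X in _ + X]big1 ?addr0 //.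
  by move=> i; rewrite inE negbK => /eqP->; rewrite scale0r.
(* The image of the special column differs from [u pivot] by the terms other than e_pivot assigned
   to the pivot, and [termV] places these in [V (L pivot)]. *)
have: u pivot \in V (L pivot) by [].
rewrite gpi (bigD1 pivot piT) /= {1}/u' eqxx u_pivotT (bigD1 pivot piT) /=.
rewrite (bigD1 pivot) /=; last by rewrite piA top_pivot /=.
rewrite {1}/u0 eqxx -addrA [X in _ -> _ + X \in _](_ : _ =
  \sum_(t in T | t != pivot) \sum_(i in A | top L A i == t) a i *: u0 i); last first.
  by apply: eq_bigr => t /andP[tT /negPf tpi]; rewrite /u' tpi ifT.
rewrite addrCA rpredDl //.
by apply: memv_suml => i /andP[/andP[iA /eqP {2}<-]]; apply: termV.
Qed.

End Existence.

(** * Dictionary between normal forms and standard flags *)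

Lemma enum_val_ltn n (S : {set 'I_n}) (s t : 'I_#|S|) :
  (s < t)%N -> (enum_val s < enum_val t)%N.
Proof.
move=> st; have x0 := enum_val s; rewrite !(enum_val_nth x0).
have tr : transitive (relpre (val : 'I_n -> nat) ltn) by move=> y x z; apply: ltn_trans.
apply: (sorted_ltn_nth tr); rewrite ?inE -?cardE ?ltn_ord //.
rewrite /enum_mem; apply: sorted_filter => //; rewrite -enumT.
by rewrite -sorted_map val_enum_ord iota_ltn_sorted.
Qed.

Section NormalForm.
Variables (R : realType) (n l : nat) (m : 'I_l -> nat).
Implicit Types (A : forall j : 'I_l, 'M[R]_(n + 1, m j)).
Implicit Types (L : 'I_(n + 1) -> 'I_l) (T : {set 'I_(n + 1)}).
Local Notation blk c := (Tagged (fun j => 'I_(m j)) c).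
Local Notation block_index := {j : 'I_l & 'I_(m j)}.
Implicit Types (f : block_index -> 'I_(n + 1)).

(** Blocks correspond to levels, while the order of the columns inside a block stays free: this is
    the ambiguity left in the normal form. *)
Definition std_indexing L T A f :=
  [/\ bijective f, forall x, L (f x) = tag x
    & forall x, col (tagged x) (A (tag x)) = std_col R T (f x)].

Lemma ecol_std_col T i : ecol R i = std_col R T (lshift 1 i).
Proof.
rewrite /std_col lshift_pivot /ecol; apply/colP => p.
case: (pivotVlshift p) => [->|[i' ->]].
  by rewrite col_mxEd !mxE eq_sym lshift_pivot.
by rewrite col_mxEu !mxE (inj_eq (@lshift_inj n 1)).
Qed.

(** Injectivity of [i_] makes the sum the indicator vector of its image. *)
Lemma special_std_col k (i_ : 'I_k -> 'I_n) T : injective i_ -> pivot \in T ->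
    (forall i, (lshift 1 i \in T) = (i \in codom i_)) ->
  col_mx (\sum_(s < k) evec R (i_ s)) 1 = std_col R T pivot.
Proof.
move=> i_inj piT TE; rewrite /std_col eqxx; apply/colP => p.
case: (pivotVlshift p) => [->|[i ->]].
  by rewrite col_mxEd !mxE piT eqxx.
rewrite col_mxEu mxE summxE TE; case: (boolP (i \in codom i_)) => [/codomP[s ->]|i_out].
  rewrite (bigD1 s) //= mxE !eqxx big1 ?addr0 // => t.
  by rewrite mxE (inj_eq i_inj) eq_sym => /negPf->.
rewrite big1 // => s _; rewrite mxE; case: eqP => // E.
by rewrite E codom_f in i_out.
Qed.

Lemma std_col_inj T : pivot \in T -> injective (std_col R T).
Proof.
move=> piT p q E; have pp := leads_std_col R p piT.
by apply: leads_inj pp _; rewrite E; apply: leads_std_col.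
Qed.

Lemma card_block_index : #|{: block_index}| = (\sum_j m j)%N.
Proof.
rewrite card_tagged sumnE big_map big_enum.
by apply: eq_bigr => j _; rewrite card_ord.
Qed.

Lemma block_index_bij f : (\sum_j m j)%N = (n + 1)%N -> injective f -> bijective f.
Proof. by move=> mn f_inj; apply: inj_card_bij; rewrite // card_block_index mn card_ord. Qed.

Lemma flag_mx_std_flag L T A f : std_indexing L T A f -> flag_mx A =1 std_flag R L T.
Proof.
move=> [f_bij Lf Af] j; rewrite /flag_mx sig_big_dep /std_flag (reindex f) /=.
  by apply: eq_big => [x|x _]; rewrite ?Lf ?andbT ?Af.
by apply: onW_bij.
Qed.

Lemma std_indexing_perm L T A A' f f' :
    std_indexing L T A f -> std_indexing L T A' f' ->
  exists s : forall j, {perm 'I_(m j)}, forall j, A' j = col_perm (s j) (A j).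
Proof.
move=> [[h hf fh] Lf Af] [f'_bij Lf' Af'].
(* The column of [A] with the same index as column [c'] of [A'] lies in the same block, since [L]
   reads off the block in both matrices. *)
have fP j (c' : 'I_(m j)) : exists c : 'I_(m j), f (blk c) = f' (blk c').
  have E : tag (h (f' (blk c'))) = j by rewrite -Lf fh Lf'.
  move: E (fh (f' (blk c'))); case: (h _) => j2 c /= E; subst j2 => Ef.
  by exists c.
have sP j : exists s : {perm 'I_(m j)}, A' j = col_perm s (A j).
  have [s_ s_P] := fin_all_exists (fP j).
  have s_inj : injective s_.
    move=> c d E; have := congr1 (fun c => f (blk c)) E.
    by rewrite !s_P => /(bij_inj f'_bij)/eqP; rewrite eq_Tagged => /eqP.
  exists (perm s_inj); apply/matrixP => r c; rewrite mxE permE.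
  have := Af' (blk c); rewrite -s_P -Af => /colP/(_ r).
  by rewrite !mxE.
by have [s s_P] := fin_all_exists sP; exists s.
Qed.

Lemma normal_form_indexing A : (\sum_j m j)%N = (n + 1)%N -> normal_form A ->
  exists L T f, [/\ pivot \in T, antichain L T & std_indexing L T A f].
Proof.
move=> mn [j0 [k [i_ [form1 form2 A_distinct [j_ [j0j j_incr i_appears i_decr]]]]]].
have i_inj : injective i_.
  move=> s t E; apply: val_inj; case: (ltngtP s t) => // /i_decr.
    by rewrite E ltnn.
  by rewrite E ltnn.
(* The support of the special column, including its last entry 1. *)
pose T := pivot |: [set lshift 1 (i_ s) | s : 'I_k].
have piT : pivot \in T by rewrite setU11.
have TE i : (lshift 1 i \in T) = (i \in codom i_).
  rewrite in_setU1 lshift_pivot /=; apply/imsetP/codomP => -[s].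
    by move=> _ /lshift_inj; exists s.
  by move=> ->; exists s.
have specialE := special_std_col i_inj piT TE.
have colP (x : block_index) : exists p, col (tagged x) (A (tag x)) = std_col R T p.
  case: x => j c /=; have [jj0|jj0] := eqVneq j j0; last first.
    by have [i ->] := form1 j jj0 c; exists (lshift 1 i); rewrite -ecol_std_col.
  subst j; have := form2 c; case: eqP => [_ ->|_ [i ->]]; first by exists pivot.
  by exists (lshift 1 i); rewrite -ecol_std_col.
have [f Af] := fin_all_exists colP.
have f_ecol x i : col (tagged x) (A (tag x)) = ecol R i -> f x = lshift 1 i.
  by rewrite Af (ecol_std_col T) => /(std_col_inj piT).
(* The only column with a nonzero last entry is the first one of block [j0];
   [distinct_basis_columns] will separate the other columns. *)
have f_pivot x : f x = pivot -> exists2 c : 'I_(m j0), c = 0%N :> nat & x = blk c.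
  case: x => j c fx; have [jj0|jj0] := eqVneq j j0; last first.
    have [i ci] := form1 j jj0 c; have /eqP := f_ecol (blk c) i ci.
    by rewrite fx eq_sym lshift_pivot.
  subst j; exists c => //; have := form2 c; case: eqP => // _ [i ci].
  by have /eqP := f_ecol (blk c) i ci; rewrite fx eq_sym lshift_pivot.
have f_inj : injective f.
  move=> x y fxy; case: (pivotVlshift (f x)) => [fx|[i fx]].
    have [c c0 ->] := f_pivot x fx; have [d d0 ->] := f_pivot y (etrans (esym fxy) fx).
    by congr Tagged; apply: val_inj; rewrite /= c0 d0.
  have Ax : col (tagged x) (A (tag x)) = ecol R i by rewrite Af fx -ecol_std_col.
  have Ay : col (tagged y) (A (tag y)) = ecol R i by rewrite Af -fxy fx -ecol_std_col.
  by have := A_distinct i _ _ _ _ Ax Ay; case: (x) (y) => [? ?] [].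
have f_bij := block_index_bij mn f_inj; have [h fK hK] := f_bij.
(* The level of an index is the block containing its column. *)
exists (fun p => tag (h p)), T, f; split=> //; last by split=> // x; rewrite fK.
have L_pivot : tag (h pivot) = j0 by have [c _ ->] := f_pivot _ (hK pivot).
have L_i s : tag (h (lshift 1 (i_ s))) = j_ s.
  have [c Ac] := i_appears s.
  by rewrite -(f_ecol (blk c) _ Ac) fK.
(* No index exceeds the pivot. The other cases are [j0 < j_ s] and the opposite monotonicities of
   [i_] and [j_]. *)
move=> s t; case/setU1P => [->|/imsetP[a _ ->]]; first by rewrite ltnNge leq_pivot.
case/setU1P => [->|/imsetP[b _ ->]]; first by rewrite L_pivot L_i.
rewrite !L_i /= => ab; apply: j_incr; case: (ltngtP b a) => // [/i_decr|/val_inj E].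
  by rewrite ltnNge ltnW.
by rewrite E ltnn in ab.
Qed.

Lemma exists_normal_form L T :
    (\sum_j m j)%N = (n + 1)%N -> pivot \in T -> antichain L T ->
    (forall j, m j = #|[pred p | L p == j]|) ->
  exists A f, normal_form A /\ std_indexing L T A f.
Proof.
move=> mn piT TL mE.
(* Listing the pivot first puts the special column at the head of its block, as form (2)
   requires. *)
pose e := pivot :: rem pivot (enum 'I_(n + 1)).
have e_perm : perm_eq (enum 'I_(n + 1)) e by apply: perm_to_rem; rewrite mem_enum.
pose e_ j := [seq p <- e | L p == j].
have e_uniq j : uniq (e_ j) by rewrite filter_uniq // -(perm_uniq e_perm) enum_uniq.
have e_size j : size (e_ j) = m j.
  by rewrite size_filter -(seq.permP e_perm) mE cardE -size_filter enumT.
pose f (x : block_index) := nth pivot (e_ (tag x)) (tagged x).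
have Lf x : L (f x) = tag x.
  have : f x \in e_ (tag x) by rewrite mem_nth // e_size.
  by rewrite mem_filter => /andP[/eqP].
have f_inj : injective f.
  case=> j c [j' c'] fE; have E : j = j' by have := congr1 L fE; rewrite !Lf.
  subst j'; congr Tagged; apply: val_inj; apply/eqP.
  by rewrite /= -(nth_uniq pivot _ _ (e_uniq j)) ?e_size //; apply/eqP.
pose A j : 'M[R]_(n + 1, m j) := \matrix_(r, c) std_col R T (f (blk c)) r 0.
have Af x : col (tagged x) (A (tag x)) = std_col R T (f x).
  by case: x => j c; apply/colP => r; rewrite !mxE.
exists A, f; split; last by split=> //; apply: block_index_bij.
have A_ecol j (c : 'I_(m j)) : f (blk c) != pivot -> exists i, col c (A j) = ecol R i.
  case: (pivotVlshift (f (blk c))) => [->|[i fc] _]; first by rewrite eqxx.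
  by exists i; rewrite (Af (blk c)) fc -ecol_std_col.
pose S := [set i | lshift 1 i \in T].
(* Levels are distinct on an antichain, so [T] has at most [l] elements, one of which is the
   pivot. *)
have S_lt : (#|S| < l)%N.
  have L_inj : {in T &, injective L}.
    move=> s t sT tT Lst; apply: val_inj; case: (ltngtP s t) => //.
      by move/(TL _ _ sT tT); rewrite Lst ltnn.
    by move/(TL _ _ tT sT); rewrite Lst ltnn.
  rewrite -[X in (_ < X)%N](card_ord l); apply: leq_trans (max_card (L @: T)).
  rewrite (card_in_imset L_inj) (cardsD1 pivot T) piT add1n ltnS.
  rewrite -(card_imset _ (@lshift_inj n 1)); apply: subset_leq_card.
  apply/subsetP => _ /imsetP[i iS ->]; rewrite !inE lshift_pivot.
  by rewrite inE in iS.
pose k : 'I_l := Ordinal S_lt.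
(* [enum_val] is increasing, whereas the normal form wants decreasing indices; their levels then
   increase by the antichain condition. *)
pose i_ (s : 'I_k) : 'I_n := enum_val (rev_ord s : 'I_#|S|).
have i_S s : lshift 1 (i_ s) \in T by have := enum_valP (rev_ord s : 'I_#|S|); rewrite inE.
have i_decr (s t : 'I_k) : (s < t)%N -> (i_ t < i_ s)%N.
  move=> st; apply: enum_val_ltn; rewrite /= ltn_sub2l //.
  by rewrite (leq_ltn_trans _ (ltn_ord t)).
have i_inj : injective i_ by move=> s t /enum_val_inj/rev_ord_inj.
have i_codom i : (lshift 1 i \in T) = (i \in codom i_).
  apply/idP/codomP => [iT|[s ->]] //; have iS : i \in S by rewrite inE.
  exists (rev_ord (enum_rank_in iS i)).
  by rewrite /i_ rev_ordK enum_rankK_in.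
exists (L pivot), k, i_; split.
- move=> j jL c; apply: A_ecol; apply: contraNneq jL => fc.
  by rewrite -fc Lf.
- move=> c; case: eqP => [c0|/eqP c0].
    rewrite (special_std_col i_inj piT i_codom) (Af (blk c)).
    by rewrite /f /= c0 /e_ /= eqxx.
  apply: A_ecol; apply: contraNneq c0; rewrite /f /= => fc.
  (* The duplicate-free list of this level already has the pivot at position 0, which is a valid
     position as the block has a column [c]. *)
  have m0 : (0 < m (L pivot))%N by rewrite (leq_ltn_trans _ (ltn_ord c)).
  rewrite -(nth_uniq pivot _ _ (e_uniq (L pivot))) ?e_size // fc.
  by rewrite /e_ /= eqxx.
- move=> i j j' c c'; rewrite (Af (blk c)) (Af (blk c')) => <-.
  by move/(std_col_inj piT)/f_inj.
exists (fun s => L (lshift 1 (i_ s))); split=> //.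
- by move=> s; apply: TL => //; rewrite ltn_pivot lshift_pivot.
- by move=> s t st; apply: TL; rewrite //= i_decr.
move=> s; have [h fK hK] := block_index_bij mn f_inj.
have := hK (lshift 1 (i_ s)); case: (h _) => j c fc.
rewrite -fc Lf; exists c; rewrite (Af (blk c)) fc.
by rewrite -ecol_std_col.
Qed.

End NormalForm.

(** * Block sizes and proof of the theorem *)

Lemma dim_std_flag (R : realType) (n l : nat) (L : 'I_(n + 1) -> 'I_l)
    (T : {set 'I_(n + 1)}) (j : 'I_l) : pivot \in T ->
  \dim (std_flag R L T j) = #|[pred p | (L p <= j)%N]|.
Proof.
move=> piT.
pose S (P : pred 'I_(n + 1)) := (\sum_(p | P p) <[std_col R T p]>)%VS.
have dimS P : (\dim (S P) <= #|P|)%N.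
  apply: (@leq_trans (\sum_(p | P p) \dim <[std_col R T p]>)); first exact: dimv_leq_sum.
  rewrite -sum1_card.
  by apply: leq_sum => p _; rewrite dim_vline leq_b1.
pose P := [pred p | (L p <= j)%N].
(* The spans of the columns of level at most [j] and of the remaining ones fill the space, so
   neither dimension can fall short of its number of generators. *)
have full : (S P + S (predC P))%VS = fullv.
  rewrite -[LHS](bigID P predT) /=; apply: subv_anti; rewrite subvf; apply/subvP => x _.
  by rewrite -(std_colK x piT); apply: memv_sumr => p _; rewrite memvZ ?memv_line.
have : (n + 1 <= \dim (S P) + \dim (S (predC P)))%N.
  apply: leq_trans (dimv_add_leqif (S P) (S (predC P))).1; rewrite full dimvf.
  by rewrite /dim /= muln1.
rewrite -[X in (X <= _)%N](card_ord (n + 1)) -(cardC P) => le_dim.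
apply/eqP; rewrite eqn_leq dimS /= -(leq_add2r #|predC P|).
by apply: leq_trans le_dim _; rewrite leq_add2l.
Qed.

(** Recovers the block sizes from the dimensions of the flag. *)
Lemma eq_partial_sums (l : nat) (m c : 'I_l -> nat) :
    (forall j : 'I_l, \sum_(k < l | (k <= j)%N) m k = \sum_(k < l | (k <= j)%N) c k)%N ->
  m =1 c.
Proof.
move=> mc j; have [a] := ubnP (j : nat); elim: a j => // a IH j ja.
have := mc j; rewrite (bigD1 j) //= [RHS](bigD1 j) //=.
rewrite [X in (m j + X)%N = _](eq_bigr c) => [/addIn //|k /andP[kj k_j]].
by apply: IH; rewrite (@leq_trans j) // ltn_neqAle k_j.
Qed.

Theorem theoremB (R : realType) (n l : nat) (m : 'I_l -> nat)
    (hm : composition (n + 1) m)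
    (V : 'I_l -> {vspace 'cV[R]_(n + 1)}) (hV : is_flag m V) :
  (exists2 A : forall j : 'I_l, 'M[R]_(n + 1, m j),
      normal_form A & borel_orbit V (flag_mx A)) /\
  (forall A A' : forall j : 'I_l, 'M[R]_(n + 1, m j),
      normal_form A -> normal_form A' ->
      borel_orbit V (flag_mx A) -> borel_orbit V (flag_mx A') ->
      exists s : forall j : 'I_l, {perm 'I_(m j)},
        forall j, A' j = col_perm (s j) (A j)).
Proof.
have [_ mn] := hm; have [V_mono V_dim V_full] := hV; split.
  (* The flag has a last step, because the empty sum is not [n + 1]. *)
  have l_gt0 : (0 < l)%N.
    by rewrite lt0n; apply: contra_eqN mn => /eqP l0; subst l; rewrite big_ord0 addn1.
  have j1P : (l.-1 < l)%N by rewrite prednK.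
  have [|L [T [piT TL LV]]] := exists_std_flag V_mono (j1 := Ordinal j1P).
    by rewrite V_full //= prednK.
  (* B' preserves dimensions, so [V j] has as many dimensions as there are indices of level at most
     [j]. *)
  have mE : m =1 fun j => #|[pred p | L p == j]|.
    apply: eq_partial_sums => j; rewrite -V_dim.
    have [b bB VE] := LV; rewrite VE dim_act_flag ?borel_unitmx // dim_std_flag //.
    rewrite -sum1_card (partition_big L (fun k : 'I_l => k <= j)%N) //=.
    apply: eq_bigr => k kj; rewrite -sum1_card; apply: eq_bigl => p.
    by rewrite !inE andbC; case: eqP => // ->.
  have [A [f [A_nf Af]]] := exists_normal_form R mn piT TL mE.
  exists A => //; have [b bB VE] := borel_orbit_sym LV; exists b => // j.
  by rewrite (flag_mx_std_flag Af).
move=> A A' A_nf A'_nf VA VA'.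
have [L [T [f [piT TL Af]]]] := normal_form_indexing mn A_nf.
have [L' [T' [f' [piT' TL' Af']]]] := normal_form_indexing mn A'_nf.
have [b bB bE] := borel_orbit_trans (borel_orbit_sym VA) VA'.
have AA' : borel_orbit (std_flag R L T) (std_flag R L' T').
  exists b => // j; rewrite -(flag_mx_std_flag Af') bE /act_flag.
  by rewrite (flag_mx_std_flag Af).
have [EL ET] := std_flag_inj piT piT' TL TL' AA'; subst L' T'.
exact: std_indexing_perm Af Af'.
Qed.
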